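(* Let $m\ge 3$ and let $\tau$ be any permutation of $\{3,4,\dots,m\}$. Then for every $n$, $|\mathrm{DA}_n(21\tau)|=|\mathrm{DA}_n(12\tau)|$.
   Context: For a permutation $\tau$ of $\{3,\dots,m\}$ written as a word $\tau_3\cdots\tau_m$, the pattern $12\tau\in\mathcal S_m$ has one-line notation $1\,2\,\tau_3\cdots\tau_m$, and the pattern $21\tau$ has one-line notation $2\,1\,\tau_3\cdots\tau_m$. A permutation $\sigma\in\mathcal S_n$ contains a pattern $\pi\in\mathcal S_m$ if there are indices $i_1<\dots<i_m$ with $\sigma(i_a)<\sigma(i_b)\iff\pi(a)<\pi(b)$; otherwise it avoids $\pi$. A word $w$ is alternating if $w_{2i-1}<w_{2i}$ and $w_{2i}>w_{2i+1}$ whenever these indices exist. A permutation is doubly alternating if it and its inverse are alternating in one-line notation. $\mathrm{DA}_n(\pi)$ is the set of doubly alternating $\sigma\in\mathcal S_n$ avoiding $\pi$. *)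

(* Defs.v *)
From mathcomp Require Import all_boot all_fingroup.

Set Implicit Arguments.
Unset Strict Implicit.
Unset Printing Implicit Defensive.

(* 'S_n permutes 'I_n = {0, ..., n-1}; the letters of the one-line word are
   shifted so that they range over {1, ..., n}. *)
Definition oneline (n : nat) (s : 'S_n) : seq nat :=
  [seq (val (s i)).+1 | i <- enum 'I_n].

(* Positions are counted from 0 here, so that ascents are required at even
   positions and descents at odd ones. *)
Definition alternating (w : seq nat) : bool :=
  all (fun j => if odd j then nth 0 w j > nth 0 w j.+1
                else nth 0 w j < nth 0 w j.+1)
      (iota 0 (size w).-1).

Definition doubly_alternating (n : nat) (s : 'S_n) : bool :=
  alternating (oneline s) && alternating (oneline s^-1%g).

Definition contains (n m : nat) (s : 'S_n) (p : 'S_m) : bool :=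
  [exists f : {ffun 'I_m -> 'I_n},
     [forall a : 'I_m, forall b : 'I_m, (a < b) ==> (f a < f b)] &&
     [forall a : 'I_m, forall b : 'I_m, (s (f a) < s (f b)) == (p a < p b)]].

Definition DA (n m : nat) (p : 'S_m) : {set 'S_n} :=
  [set s : 'S_n | doubly_alternating s & ~~ contains s p].

Lemma oneline_inj (n : nat) : injective (@oneline n).
Proof.
move=> s t /eq_in_map eq_st; apply/permP=> i; apply: val_inj.
by apply: succn_inj; apply: eq_st; rewrite mem_enum.
Qed.

Lemma oneline_ex (m : nat) (w : seq nat) :
  perm_eq w (iota 1 m) -> exists p : 'S_m, oneline p = w.
Proof.
move=> w_perm; have sz_w : size w = m by rewrite (perm_size w_perm) size_iota.
have uw : uniq w by rewrite (perm_uniq w_perm) iota_uniq.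
have w_rng (i : 'I_m) : 0 < nth 0 w i <= m.
  have : nth 0 w i \in iota 1 m by rewrite -(perm_mem w_perm) mem_nth ?sz_w.
  by rewrite mem_iota add1n ltnS.
have lt_w (i : 'I_m) : (nth 0 w i).-1 < m.
  by case/andP: (w_rng i) => w_gt0; rewrite prednK.
have inj_w : injective (fun i : 'I_m => Ordinal (lt_w i)).
  move=> i j [] eq_ij; apply/val_inj/eqP.
  rewrite -(nth_uniq 0 _ _ uw) ?sz_w ?ltn_ord //; apply/eqP.
  by case/andP: (w_rng i) (w_rng j) => wi _ /andP[wj _];
    rewrite -(prednK wi) eq_ij prednK.
exists (perm inj_w); apply: (@eq_from_nth _ 0).
  by rewrite size_map size_enum_ord.
move=> i; rewrite size_map size_enum_ord => lt_im.
rewrite (nth_map (Ordinal lt_im)) ?size_enum_ord // permE /=.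
rewrite nth_enum_ord //.
by case/andP: (w_rng (Ordinal lt_im)) => w_gt0 _; rewrite prednK.
Qed.

Lemma oneline12_ex (m : nat) (tau : seq nat) :
  3 <= m -> perm_eq tau (iota 3 (m - 2)) ->
  exists p : 'S_m, oneline p = 1 :: 2 :: tau.
Proof.
case: m => [|[|m]] // _; rewrite subn2 => tau_perm; apply: oneline_ex.
by rewrite /= !perm_cons.
Qed.

Lemma oneline21_ex (m : nat) (tau : seq nat) :
  3 <= m -> perm_eq tau (iota 3 (m - 2)) ->
  exists p : 'S_m, oneline p = 2 :: 1 :: tau.
Proof.
case: m => [|[|m]] // _; rewrite subn2 => tau_perm; apply: oneline_ex.
by rewrite (perm_catCA [:: 2] [:: 1] tau) /= !perm_cons.
Qed.

(* Main.v *)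
(** Call a cell (i, v) active when some occurrence of the pattern tau lies
    strictly to its right and above it.  The active cells form a Young diagram,
    and s contains 12tau (resp. 21tau) iff two of its points form a 12 (resp. 21)
    whose bounding box is active.  Group permutations by their active cells
    together with their points outside the diagram.
    Each group has exactly one avoider of 12tau and exactly one avoider of
    21tau; they are reached by repeatedly swapping the values of two offending
    points, which only moves points inside the diagram.  Where the diagram drops
    between two adjacent positions, the right one carries a point above the drop.
    Hence, for an alternating avoider of either pattern, every point in the
    diagram sits at an even position (counting from 0), and then alternation of
    any member of the group is decided by the group alone.  The same holds for
    the inverse by transposing the diagram. *)

Require Import Defs.
From mathcomp Require Import all_boot all_fingroup.
From mathcomp Require Import zify.

Set Implicit Arguments.
Unset Strict Implicit.
Unset Printing Implicit Defensive.

(** * One-line words and alternation *)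

Lemma nth_oneline (n : nat) (s : 'S_n) (i : 'I_n) :
  nth 0 (oneline s) i = (s i).+1.
Proof. by rewrite (nth_map i) ?size_enum_ord // nth_ord_enum. Qed.

Lemma perm_val_ltNge (n : nat) (s : 'S_n) (i j : 'I_n) :
  i != j -> (s i < s j) = ~~ (s j < s i).
Proof.
by move=> ne_ij; rewrite -leqNgt ltn_neqAle val_eqE (inj_eq perm_inj) ne_ij.
Qed.

(** Letters are distinct, so a descent is a failed ascent and one boolean equation serves both
    parities. *)
Lemma alternating_onelineP (n : nat) (s : 'S_n) :
  reflect (forall i j : 'I_n, j = i.+1 :> nat -> (s i < s j) = ~~ odd i)
          (alternating (oneline s)).
Proof.
rewrite /alternating /oneline size_map size_enum_ord -/(oneline s).
apply: (iffP allP) => [alt_s i j ij|alt_s i].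
  have: (i : nat) \in iota 0 n.-1 by rewrite mem_iota; move: (ltn_ord j); lia.
  move/alt_s; rewrite -ij !nth_oneline.
  have: (s i < s j) = ~~ (s j < s i).
    by apply: perm_val_ltNge; rewrite -val_eqE /=; lia.
  by case: odd => /=; lia.
rewrite mem_iota => lt_i; have lt_in : i < n by lia.
have lt_jn : i.+1 < n by lia.
have := alt_s (Ordinal lt_in) (Ordinal lt_jn) erefl.
have: Ordinal lt_in != Ordinal lt_jn by rewrite -val_eqE /=; lia.
move/(perm_val_ltNge s).
have /= -> := nth_oneline s (Ordinal lt_in).
have /= -> := nth_oneline s (Ordinal lt_jn).
by case: odd => /=; lia.
Qed.

(** * Permutations relative to a fixed Young diagram *)

Section Diagram.

Variables (n : nat) (P : rel 'I_n).

(* avoids true excludes 12 and avoids false excludes 21. *)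
Definition avoids (b : bool) (s : 'S_n) : Prop :=
  forall i j : 'I_n, i < j -> (s i < s j) = b -> P j (s i) -> P j (s j) -> False.

Definition agree_outside (s t : 'S_n) : Prop :=
  forall i, ~~ (P i (s i) && P i (t i)) -> s i = t i.

Definition gap_right (s : 'S_n) : Prop :=
  forall i j v : 'I_n, j = i.+1 :> nat -> P i v -> ~~ P j v -> v < s j.

Hypothesis P_down : forall i i' v v' : 'I_n,
  i' <= i -> v' <= v -> P i v -> P i' v'.

Lemma agree_outside_inside s t i : agree_outside s t -> P i (t i) -> P i (s i).
Proof. by move=> st; apply: contraLR => nPs; rewrite -st ?(negPf nPs). Qed.

(** At the last position [j] of disagreement both values are inside. The value of each at [j] occurs
    earlier in the other, which gives two pairs ending at [j] of opposite order types; one of them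
    is forbidden. *)
Lemma avoids_unique b s t :
  agree_outside s t -> avoids b s -> avoids b t -> s = t.
Proof.
move=> st av_s av_t; apply/permP.
(* Agreement is extended leftwards from the vacuous case [d = n]; reaching [d = 0] is the goal. *)
suff [d] : exists d, forall i : 'I_n, d <= i -> s i = t i.
  elim: d => [|d IHd] eq_st; first by move=> i; apply: eq_st.
  apply: IHd => j; rewrite leq_eqVlt => /orP[/eqP dj|]; last exact: eq_st.
  (* By injectivity, a value that [y] takes at [j] cannot be taken by [x] at [j] or at a later,
     common point. *)
  have low u (x y : 'S_n) : (forall i : 'I_n, j < i -> x i = y i) ->
      x j != y j -> x u = y j -> u < j.
    move=> xy ne_j xu; rewrite ltnNge leq_eqVlt; apply/negP=> /orP[/eqP|] ju.
      by case/eqP: ne_j; rewrite -xu (val_inj ju).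
    have /perm_inj uj : y u = y j by rewrite -xu xy.
    by rewrite uj ltnn in ju.
  have {}eq_st (i : 'I_n) : j < i -> s i = t i by rewrite -dj; apply: eq_st.
  apply/eqP/negP => /negP ne_j.
  have /andP[Ps Pt] : P j (s j) && P j (t j).
    by apply: contraR ne_j => /st/eqP.
  have ltn_or : (s j < t j) || (t j < s j).
    by move: ne_j; rewrite -val_eqE /=; lia.
  pose u := (s^-1)%g (t j); pose w := (t^-1)%g (s j).
  have su : s u = t j by rewrite permKV.
  have tw : t w = s j by rewrite permKV.
  have uj : u < j by apply: low su.
  have wj : w < j.
    by apply: (low w t s _ _ tw) => [i /eq_st|]; last rewrite eq_sym.
  have := av_s u j uj; have := av_t w j wj; rewrite su tw Ps Pt.
  by case: b {av_s av_t} => hw hu; case: ltngtP ltn_or hw hu => // *; auto.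
by exists n => i; rewrite leqNgt ltn_ord.
Qed.

Hypothesis P_last : forall i v : 'I_n, P i v -> i.+1 < n.

(** At an odd position, the ascent from the left neighbour is a forbidden 12. The descent to the
    right neighbour is a forbidden 21: by the gap property its corner [(i + 1, s i)] is still
    inside, as [s] would otherwise rise there. *)
Lemma inside_even b s i : gap_right s -> avoids b s ->
  (forall i j : 'I_n, j = i.+1 :> nat -> (s i < s j) = ~~ odd i) ->
  P i (s i) -> ~~ odd i.
Proof.
move=> gap av alt_s Pi; apply/negP=> odd_i; case: b av => av.
  have lt_i' : i.-1 < n by apply: leq_ltn_trans (ltn_ord i); lia.
  pose i' := Ordinal lt_i'; have ii' : i = i'.+1 :> nat by rewrite /= prednK ?odd_gt0.
  have up : s i' < s i by rewrite (alt_s _ _ ii'); move: odd_i; rewrite ii' /=; lia.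
  by apply: (av i' i) => //; [lia | apply: P_down Pi; lia].
pose j := Ordinal (P_last Pi).
have down : (s i < s j) = false by rewrite (alt_s i j) // odd_i.
have Pj : P j (s i) by apply: contraFT down => /gap; apply.
apply: (av i j) => //=; apply: P_down Pj => //.
by move: down; lia.
Qed.

(** Two adjacent points cannot both be inside, by parity. If only the left one is, the gap property
    forces an ascent; if only the right one is, down-closure forbids one. If neither is, [s] and [t]
    agree at both positions. *)
Lemma alternating_transfer s t : gap_right t -> agree_outside s t ->
  (forall i, P i (s i) -> ~~ odd i) ->
  (forall i j : 'I_n, j = i.+1 :> nat -> (s i < s j) = ~~ odd i) ->
  (forall i j : 'I_n, j = i.+1 :> nat -> (t i < t j) = ~~ odd i).
Proof.
move=> gap st even_s alt_s i j ij.
have even_t k : P k (t k) -> ~~ odd k.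
  by move/(agree_outside_inside st)/even_s.
have ne_ij : i != j by rewrite -val_eqE /=; lia.
have [Pi|nPi] := boolP (P i (t i)); have [Pj|nPj] := boolP (P j (t j)).
- by have := even_t _ Pi; have := even_t _ Pj; rewrite ij /= => /negPn->.
- rewrite (even_t _ Pi) (perm_val_ltNge t ne_ij); apply/negP=> lt_ji.
  have nPji : ~~ P j (t i) by apply: contra nPj; apply: P_down; lia.
  by have := gap _ _ _ ij Pi nPji; lia.
- have odd_i : odd i by have := even_t _ Pj; rewrite ij /= negbK.
  rewrite odd_i; apply/negP=> lt_ij; case/negP: nPi.
  by apply: P_down Pj; lia.
- have st_i : s i = t i by apply: st; rewrite (negPf nPi) andbF.
  have st_j : s j = t j by apply: st; rewrite (negPf nPj) andbF.
  by rewrite -st_i -st_j; apply: alt_s.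
Qed.

End Diagram.

(** * Inverse permutations and the transposed diagram *)

Section Transpose.

Variables (n : nat) (P : rel 'I_n).
Let Pt : rel 'I_n := fun v i => P i v.

Hypothesis P_down : forall i i' v v' : 'I_n,
  i' <= i -> v' <= v -> P i v -> P i' v'.

(** Transposing preserves the order type of a pair and the upper right corner of its bounding
    box. *)
Lemma avoids_inv b (s : 'S_n) : avoids P b s -> avoids Pt b s^-1%g.
Proof.
rewrite /Pt => av u v uv; pose i := (s^-1)%g u; pose j := (s^-1)%g v.
rewrite -/i -/j => cmp Pi Pj.
have si : s i = u by rewrite permKV.
have sj : s j = v by rewrite permKV.
case: b av cmp => av cmp.
  by apply: (av i j); rewrite ?si ?sj //; apply: P_down Pj; lia.
have ne : i != j by apply: contraTneq uv => ij; rewrite -si -sj ij ltnn.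
have ji : j < i by move: ne; rewrite -val_eqE /=; lia.
by apply: (av j i); rewrite ?si ?sj //; [lia | apply: P_down Pi; lia].
Qed.

Lemma agree_outside_inv (s t : 'S_n) :
  agree_outside P s t -> agree_outside Pt s^-1%g t^-1%g.
Proof.
rewrite /Pt => st v; rewrite negb_and => /orP[] nP.
  have := st ((s^-1)%g v); rewrite permKV (negPf nP) => /(_ isT) e.
  by apply: (@perm_inj _ t); rewrite -e permKV.
have := st ((t^-1)%g v); rewrite permKV (negPf nP) andbF => /(_ isT) e.
by apply: (@perm_inj _ s); rewrite e permKV.
Qed.

End Transpose.

(** * The diagram of active cells *)

Section Active.

Variables (n k : nat) (r : rel 'I_k).
Implicit Types (s t : 'S_n) (g : {ffun 'I_k -> 'I_n}) (i v : 'I_n).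

(** Only the relative order [r] of the letters of tau enters, so 12tau and 21tau share one
    diagram. *)
Definition occurrence s g : bool :=
  [forall a : 'I_k, forall b : 'I_k, (a < b) ==> (g a < g b)] &&
  [forall a : 'I_k, forall b : 'I_k, (s (g a) < s (g b)) == r a b].

Definition active s : rel 'I_n := fun i v =>
  [exists g, occurrence s g && [forall a, (i < g a) && (v < s (g a))]].

Lemma activeP s i v :
  reflect (exists2 g, occurrence s g & forall a, i < g a /\ v < s (g a))
          (active s i v).
Proof.
apply: (iffP existsP) => [[g /andP[og /forallP ne]]|[g og ne]]; exists g => //.
  by move=> a; apply/andP.
by rewrite og; apply/forallP=> a; apply/andP.
Qed.

Lemma active_down s (i i' v v' : 'I_n) :
  i' <= i -> v' <= v -> active s i v -> active s i' v'.
Proof.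
move=> ii vv /activeP[g og ne]; apply/activeP; exists g => // a.
by have [] := ne a; lia.
Qed.

(** If the witness for [(i, v)] fails for [(j, v)], it must use position [j] itself, so the point
    there is above [v]. *)
Lemma active_gap s : gap_right (active s) s.
Proof.
move=> i j v ij /activeP[g og ne]; rewrite ltnNge; apply: contra => le_v.
apply/activeP; exists g => // a; have [lt_i lt_v] := ne a; split=> //.
rewrite ltn_neqAle ij lt_i andbT -ij; apply: contraTneq lt_v => jg.
by rewrite -leqNgt -(val_inj jg).
Qed.

Lemma active_gap_inv s : gap_right (fun v i => active s i v) s^-1%g.
Proof.
move=> v w i vw /activeP[g og ne]; rewrite ltnNge; apply: contra => le_i.
apply/activeP; exists g => // a; have [lt_i lt_v] := ne a; split=> //.
rewrite ltn_neqAle vw lt_v andbT -vw; apply: contraTneq lt_i => wg.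
by rewrite -leqNgt; move: le_i; rewrite (val_inj wg) permK.
Qed.

(** Supplies the right neighbour used in [inside_even]. For [k = 0] the empty occurrence would make
    every cell active. *)
Lemma active_last s (i v : 'I_n) : 0 < k -> active s i v -> i.+1 < n.
Proof.
move=> k_gt0 /activeP[g _ /(_ (Ordinal k_gt0))[lt_i _]].
exact: leq_ltn_trans lt_i (ltn_ord _).
Qed.

Lemma active_last_inv s (i v : 'I_n) : 0 < k -> active s i v -> v.+1 < n.
Proof.
move=> k_gt0 /activeP[g _ /(_ (Ordinal k_gt0))[_ lt_v]].
exact: leq_ltn_trans lt_v (ltn_ord _).
Qed.

(* If a letter of the occurrence is active, move to an occurrence right and above
   of it; this terminates since positions increase. *)
Lemma active_outside s i v : active s i v ->
  exists2 g, occurrence s g & forall a,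
    [/\ i < g a, v < s (g a) & ~~ active s (g a) (s (g a))].
Proof.
have [d] := ubnP (n - i); elim: d i v => // d IHd i v le_d /activeP[g og ne].
have [/forallP out|/forallPn[a]] :=
  boolP [forall a, ~~ active s (g a) (s (g a))].
  by exists g => // a; have [] := ne a; split.
have [lt_i lt_v] := ne a; rewrite negbK => /IHd[|h oh neh].
  by move: (ltn_ord (g a)); lia.
by exists h => // c; have [? ?] := neh c; split=> //; lia.
Qed.

Lemma eq_occurrence s t g :
  (forall a, s (g a) = t (g a)) -> occurrence s g -> occurrence t g.
Proof.
move=> eq_g /andP[incr /'forall_forallP iso]; rewrite /occurrence incr.
by apply/'forall_forallP=> a b; rewrite -!eq_g.
Qed.

(** An active cell of [s] has a witness made of outside points, which [t] shares. A witness in [t]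
    either consists of shared points or has a point in the diagram of [s], and then down-closure
    applies. *)
Lemma active_agree s t : agree_outside (active s) s t -> active t =2 active s.
Proof.
move=> st i v; apply/idP/idP; last first.
  case/active_outside=> g og ne; apply/activeP.
  have eq_g a : s (g a) = t (g a) by apply: st; case: (ne a) => _ _ /negPf->.
  exists g; first exact: eq_occurrence og.
  by move=> a; rewrite -eq_g; case: (ne a).
case/activeP=> g og ne.
have [/existsP[a Pa]|/existsPn out] :=
  boolP [exists a, active s (g a) (t (g a))].
  by have [? ?] := ne a; apply: active_down Pa; lia.
have eq_g a : t (g a) = s (g a) by rewrite st // (negPf (out a)) andbF.
apply/activeP; exists g; first exact: eq_occurrence og.
by move=> a; rewrite -eq_g.
Qed.

Definition diagram_key s : {set 'I_n * 'I_n} * {set 'I_n * 'I_n} :=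
  ([set c | active s c.1 c.2],
   [set c | (s c.1 == c.2) && ~~ active s c.1 c.2]).

Lemma diagram_keyP s t :
  diagram_key s = diagram_key t <-> agree_outside (active s) s t.
Proof.
split=> [[/setP eqA /setP eqO] i|st].
  have eq_act j v : active s j v = active t j v by have := eqA (j, v); rewrite !inE.
  rewrite negb_and => /orP[] nP.
    have := eqO (i, s i); rewrite !inE /= eqxx -eq_act nP !andbT.
    by move/esym/eqP.
  by have := eqO (i, t i); rewrite !inE /= eqxx -eq_act nP !andbT => /eqP.
have eq_act := active_agree st.
congr pair; apply/setP=> -[i v]; rewrite !inE /= ?eq_act //.
have [|nP] := boolP (active s i v); first by rewrite !andbF.
rewrite !andbT; apply/eqP/eqP => eqv.
  by rewrite -st ?eqv ?(negPf nP).
by rewrite st ?eqv ?(negPf nP) ?andbF.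
Qed.

Lemma avoids_exists b s :
  exists2 t, diagram_key t = diagram_key s & avoids (active t) b t.
Proof.
(* Increasing weights make exchanging a 12 lower the sum [M]; decreasing weights do so for a 21. A
   minimiser with the same key thus has no offending pair. *)
pose w (i : 'I_n) := if b then i : nat else n - i.
pose M t := \sum_i w i * t i.
case: (@arg_minnP _ s (fun t => diagram_key t == diagram_key s) M) => //.
move=> t /eqP key_t min_t; exists t => // i j ij cmp Pji Pjj.
pose t' := (tperm i j * t)%g.
have t'i : t' i = t j by rewrite permM tpermL.
have t'j : t' j = t i by rewrite permM tpermR.
have ne_ji : j != i by rewrite -val_eqE /=; lia.
have t'D l : l != i -> l != j -> t' l = t l.
  by move=> li lj; rewrite permM tpermD // eq_sym.
have key_t' : diagram_key t' == diagram_key s.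
  rewrite -key_t; apply/eqP/esym/diagram_keyP => l.
  (* Before and after the exchange, the moved points lie in the active box of the pair. *)
  have [->|li] := eqVneq l i.
    have le_ij := ltnW ij.
    by rewrite t'i (active_down le_ij _ Pji) ?(active_down le_ij _ Pjj).
  have [->|lj] := eqVneq l j; first by rewrite t'j Pji Pjj.
  by rewrite t'D.
have := min_t _ key_t'; rewrite leqNgt => /negP; apply.
rewrite /M (bigD1 i) // (bigD1 j) //= [ltnRHS](bigD1 i) // (bigD1 j ne_ji) /=.
rewrite t'i t'j !addnA.
rewrite (eq_bigr (fun l => w l * t l)); last first.
  by move=> l /andP[li lj]; rewrite t'D.
rewrite ltn_add2r /w; case: b cmp {w M min_t} => cmp.
  by nia.
have: t j < t i by move: cmp (perm_val_ltNge t ne_ji) => ->.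
by have := ltn_ord j; nia.
Qed.

Lemma doubly_alternating_transfer b s t : 0 < k ->
  diagram_key s = diagram_key t -> avoids (active s) b s ->
  doubly_alternating s -> doubly_alternating t.
Proof.
move=> k_gt0 /diagram_keyP st av /andP[alt_s alt_s'].
have eq_act := active_agree st.
have gap_t : gap_right (active s) t.
  by move=> i j v; rewrite -!eq_act; apply: active_gap.
have gap_t' : gap_right (fun v i => active s i v) t^-1%g.
  by move=> i j v; rewrite -!eq_act; apply: active_gap_inv.
have downT (i i' v v' : 'I_n) :
    i' <= i -> v' <= v -> active s v i -> active s v' i'.
  by move=> ii vv; apply: active_down.
apply/andP; split; apply/alternating_onelineP.
  move/alternating_onelineP in alt_s.
  apply: (alternating_transfer (@active_down s) gap_t st _ alt_s) => i.
  apply: (inside_even (@active_down s) _ (@active_gap s) av alt_s) => i' v.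
  exact: active_last.
move/alternating_onelineP in alt_s'.
have st' := agree_outside_inv st.
apply: (alternating_transfer downT gap_t' st' _ alt_s') => i.
have av' := avoids_inv (@active_down s) av.
apply: (inside_even downT _ (@active_gap_inv s) av' alt_s') => i' v.
exact: active_last_inv.
Qed.

End Active.

(** * Pattern containment in terms of active cells *)

Section Contains.

Variables (n k : nat) (p : 'S_(2 + k)) (r : rel 'I_k).
Let p0 := p (lshift k ord0).
Let p1 := p (lshift k ord_max).

Hypothesis rE : forall a b, r a b = (p (rshift 2 a) < p (rshift 2 b)).
Hypothesis p0_lt : p0 < 2.
Hypothesis p1_lt : p1 < 2.

(** The first two letters of [p] are its two smallest, so the other letters of an occurrence lie to
    the right of and above both. *)
Lemma avoidsP (s : 'S_n) : ~~ contains s p <-> avoids (active r s) (p0 < p1) s.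
Proof.
have ne01 : (p0 : nat) != p1 by rewrite val_eqE (inj_eq perm_inj).
have p_ge2 a : 2 <= p (rshift 2 a).
  have : (p (rshift 2 a) : nat) != p0.
    by rewrite val_eqE (inj_eq perm_inj) eq_sym eq_lrshift.
  have : (p (rshift 2 a) : nat) != p1.
    by rewrite val_eqE (inj_eq perm_inj) eq_sym eq_lrshift.
  by lia.
split=> [nc i j ij cmp|av].
  (* The two activity hypotheses may have different witnesses; the one for the larger value lies
     above both points. *)
  wlog [v lt_v Pv] : / exists2 v : 'I_n, s i <= v /\ s j <= v & active r s j v.
    move=> IH Pi Pj; have [le|lt] := leqP (s i) (s j).
      by apply: IH => //; exists (s j).
    by apply: IH => //; exists (s i) => //; split=> //; lia.
  move=> _ _; case/negP: nc; case/activeP: Pv => g /andP[].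
  move=> /'forall_'forall_implyP incr /'forall_forallP iso ne.
  pose f : {ffun 'I_(2 + k) -> 'I_n} := [ffun a => match split a with
    | inl b => if b == ord0 then i else j | inr c => g c end].
  have f0 : f (lshift k ord0) = i by rewrite ffunE (unsplitK (inl _)).
  have f1 : f (lshift k ord_max) = j by rewrite ffunE (unsplitK (inl _)).
  have f2 a : f (rshift 2 a) = g a by rewrite ffunE (unsplitK (inr _)).
  have cases (x : 'I_(2 + k)) :
      [\/ x = lshift k ord0, x = lshift k ord_max | exists c, x = rshift 2 c].
    rewrite -(splitK x); case: (split x) => [y|c]; last by constructor 3; exists c.
    by case: y => [[|[|//]]] ?; [constructor 1 | constructor 2];
      congr lshift; apply: val_inj.
  have ne_s : s i != s j by rewrite (inj_eq perm_inj) -val_eqE /=; lia.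
  apply/existsP; exists f; apply/andP; split.
    apply/'forall_'forall_implyP => a b.
    case: (cases a) (cases b) => [->|->|[c ->]] [->|->|[d ->]];
      rewrite ?f0 ?f1 ?f2 //=.
    - by case: (ne d); lia.
    - by case: (ne d); lia.
    - by rewrite ltn_add2l; apply: incr.
  apply/'forall_forallP => a b.
  case: (cases a) (cases b) => [->|->|[c ->]] [->|->|[d ->]];
    rewrite ?f0 ?f1 ?f2 -/p0 -/p1 ?ltnn //.
  - exact/eqP.
  - by move: (ne d) (p_ge2 d); lia.
  - by move: ne_s cmp; rewrite -val_eqE /=; lia.
  - by move: (ne d) (p_ge2 d); lia.
  - by move: (ne c) (p_ge2 c); lia.
  - by move: (ne c) (p_ge2 c); lia.
  - by rewrite -rE.
rewrite /contains; apply/existsP=> -[f /andP[]].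
move=> /'forall_'forall_implyP incr /'forall_'forall_eqP iso.
pose a0 : 'I_(2 + k) := lshift k ord0; pose a1 : 'I_(2 + k) := lshift k ord_max.
(* The images of the letters of tau witness activity for both low letters. *)
have act a : p a < 2 -> active r s (f a1) (s (f a)).
  move=> pa; apply/activeP; exists [ffun c => f (rshift 2 c)] => [|c].
    apply/andP; split; last first.
      by apply/'forall_'forall_eqP => c d; rewrite !ffunE iso rE.
    by apply/'forall_'forall_implyP => c d cd; rewrite !ffunE incr //= ltn_add2l.
  by rewrite ffunE incr // iso; have := p_ge2 c; lia.
by apply: (av (f a0) (f a1)); [exact: incr | exact: iso | exact: act | exact: act].
Qed.

End Contains.

(** * Counting both sets by their keys *)

Theorem theorem6p6 (m : nat) (hm : 3 <= m)
    (tau : seq nat) (htau : perm_eq tau (iota 3 (m - 2)))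
    (p12 p21 : 'S_m)
    (hp12 : oneline p12 = 1 :: 2 :: tau)
    (hp21 : oneline p21 = 2 :: 1 :: tau)
    (n : nat) :
  #|DA n p21| = #|DA n p12|.
Proof.
case: m hm p12 p21 hp12 hp21 {htau} => [|[|[|k]]] // _ p12 p21 hp12 hp21.
pose a0 : 'I_(2 + k.+1) := lshift k.+1 ord0.
pose a1 : 'I_(2 + k.+1) := lshift k.+1 ord_max.
have [p0 p1] : p12 a0 = 0 :> nat /\ p12 a1 = 1 :> nat.
  have := nth_oneline p12 a0; have := nth_oneline p12 a1.
  by rewrite hp12 => -[] <- [] <-.
have [q0 q1] : p21 a0 = 1 :> nat /\ p21 a1 = 0 :> nat.
  have := nth_oneline p21 a0; have := nth_oneline p21 a1.
  by rewrite hp21 => -[] <- [] <-.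
have shiftE (p : 'S_(2 + k.+1)) (x y : nat) : oneline p = x :: y :: tau ->
    forall a : 'I_k.+1, nth 0 tau a = (p (rshift 2 a)).+1.
  by move=> hp a; have := nth_oneline p (rshift 2 a); rewrite hp.
pose r : rel 'I_k.+1 := fun a b => nth 0 tau a < nth 0 tau b.
have r12 a b : r a b = (p12 (rshift 2 a) < p12 (rshift 2 b)).
  by rewrite /r !(shiftE _ _ _ hp12).
have r21 a b : r a b = (p21 (rshift 2 a) < p21 (rshift 2 b)).
  by rewrite /r !(shiftE _ _ _ hp21).
have av12 (s : 'S_n) : ~~ contains s p12 <-> avoids (active r s) true s.
  by have := @avoidsP n _ p12 r r12; rewrite -/a0 -/a1 p0 p1; apply.
have av21 (s : 'S_n) : ~~ contains s p21 <-> avoids (active r s) false s.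
  by have := @avoidsP n _ p21 r r21; rewrite -/a0 -/a1 q0 q1; apply.
(* Uniqueness makes the key injective on avoiders. *)
have card_DA b (p : 'S_k.+3) :
    (forall s : 'S_n, ~~ contains s p <-> avoids (active r s) b s) ->
    #|DA n p| = #|diagram_key r @: DA n p|.
  move=> av; rewrite card_in_imset // => s t.
  rewrite !inE => /andP[_ /av av_s] /andP[_ /av av_t] key_st.
  have st : agree_outside (active r s) s t by apply/diagram_keyP.
  apply: (avoids_unique st av_s) => i j; rewrite -!(active_agree st).
  exact: av_t.
(* Existence gives an avoider of [q] with the same key, and alternation transfers to it. *)
have sub_key b c (p q : 'S_k.+3) :
    (forall s : 'S_n, ~~ contains s p <-> avoids (active r s) b s) ->
    (forall s : 'S_n, ~~ contains s q <-> avoids (active r s) c s) ->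
    diagram_key r @: DA n p \subset diagram_key r @: DA n q.
  move=> av_p av_q; apply/subsetP=> _ /imsetP[s + ->].
  rewrite inE => /andP[da_s /av_p av_s].
  have [t key_t av_t] := avoids_exists r c s.
  apply/imsetP; exists t => //; rewrite inE (introT idP (proj2 (av_q t) av_t)).
  by rewrite andbT; apply: doubly_alternating_transfer av_s da_s.
rewrite (card_DA _ _ av12) (card_DA _ _ av21); congr #|pred_of_set _|.
apply/eqP; rewrite eqEsubset.
by rewrite (sub_key _ _ _ _ av12 av21) (sub_key _ _ _ _ av21 av12).
Qed.
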